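(* The logic $\Sigma_H$ is sound and (weakly) complete with respect to the class of Harsanyi type spaces: for every formula $\phi$ of $\mathcal{L}$, $\phi\in\Sigma_H$ if and only if $\phi$ is valid in every probability model based on a Harsanyi type space (equivalently, every $\Sigma_H$-consistent formula is satisfied at some state of some probability model based on a Harsanyi type space, and conversely).
   Context: Language $\mathcal{L}$: formulas are given by $\phi ::= p \mid \neg\phi \mid \phi_1\wedge\phi_2 \mid L_r\phi$, with $p$ from a countably infinite set $AP$ of propositional letters and $r\in\mathbb{Q}\cap[0,1]$. $M_r\phi$ abbreviates $L_{1-r}\neg\phi$. All indices are rationals in $[0,1]$. A logic is a set of formulas containing all propositional tautologies and closed under modus ponens and uniform substitution. $\Sigma_+$ is the smallest logic containing (A1) $L_0\phi$; (A2) $L_r\top$; (A3) $L_r(\phi\wedge\psi)\wedge L_t(\phi\wedge\neg\psi)\to L_{r+t}\phi$ for $r+t\le 1$; (A4) $\neg L_r(\phi\wedge\psi)\wedge\neg L_s(\phi\wedge\neg\psi)\to\neg L_{r+s}\phi$ for $r+s\le1$; (A5) $L_r\phi\to\neg L_s\neg\phi$ for $r+s>1$; and closed under (DIS): from $\phi\leftrightarrow\psi$ infer $L_r\phi\leftrightarrow L_r\psi$; and (ARCH): if $\gamma\to L_s\phi$ is a theorem for all $s<r$, then $\gamma\to L_r\phi$ is a theorem. $\Sigma_H$ is the smallest logic containing these axioms together with $(4_p)$ $L_r\phi\to L_1L_r\phi$ and $(5_p)$ $\neg L_r\phi\to L_1\neg L_r\phi$, and closed under (DIS) and (ARCH). A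 formula $\phi$ is $\Sigma_H$-consistent if $\phi\to\bot\notin\Sigma_H$. A type space is $\langle\Omega,\mathcal{A},T\rangle$ where $\Omega$ is a nonempty set, $\mathcal{A}$ is a $\sigma$-algebra on $\Omega$, and $T$ is a measurable map from $\Omega$ to the space $\Delta(\Omega,\mathcal{A})$ of probability measures on $(\Omega,\mathcal{A})$, endowed with the $\sigma$-algebra generated by the sets $\{\mu:\mu(E)\ge r\}$ ($E\in\mathcal{A}$, $r\in[0,1]$ rational). Put $[T(w)]=\{w'\in\Omega: T(w')=T(w)\}$. The type space is a Harsanyi type space if $T(w)(E)=1$ for all $w\in\Omega$ and all $E\in\mathcal{A}$ with $[T(w)]\subseteq E$. A probability model is a type space together with $v:AP\to\mathcal{A}$. Satisfaction: $w\models p$ iff $w\in v(p)$; Boolean clauses as usual; $w\models L_r\phi$ iff $T(w)([[\phi]])\ge r$, where $[[\phi]]=\{w: w\models\phi\}$ (always measurable). $\phi$ is valid in a model if it holds at all its states. *)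

(* Defs.v *)
From HB Require Import structures.
From mathcomp Require Import all_boot all_order all_algebra.
From mathcomp Require Import all_classical all_reals all_analysis.

Import Order.TTheory GRing.Theory Num.Theory.
Local Open Scope classical_set_scope.
Local Open Scope ring_scope.

Definition AP : Type := nat.

Definition idx : Type := {r : rat | 0 <= r <= 1}.
Definition idx0 : idx := exist _ 0 isT.
Definition idx1 : idx := exist _ 1 isT.

Inductive prob_formula : Type :=
| Atom of AP
| Neg of prob_formula
| And of prob_formula & prob_formula
| L of idx & prob_formula.

Definition Imp (phi psi : prob_formula) : prob_formula := Neg (And phi (Neg psi)).
Definition Iff (phi psi : prob_formula) : prob_formula := And (Imp phi psi) (Imp psi phi).
Definition Bot : prob_formula := And (Atom 0%N) (Neg (Atom 0%N)).
Definition Top : prob_formula := Neg Bot.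

Fixpoint fsubst (s : AP -> prob_formula) (phi : prob_formula) : prob_formula :=
  match phi with
  | Atom p => s p
  | Neg phi1 => Neg (fsubst s phi1)
  | And phi1 phi2 => And (fsubst s phi1) (fsubst s phi2)
  | L r phi1 => L r (fsubst s phi1)
  end.

(* Boolean evaluation in which letters and formulas L r phi are treated as
   independent propositional atoms, with truth values given by [a]. *)
Fixpoint beval (a : prob_formula -> bool) (phi : prob_formula) : bool :=
  match phi with
  | Neg phi1 => ~~ beval a phi1
  | And phi1 phi2 => beval a phi1 && beval a phi2
  | Atom _ | L _ _ => a phi
  end.

Definition tautology (phi : prob_formula) : Prop := forall a, beval a phi.

Definition logic (S : set prob_formula) : Prop :=
  [/\ tautology `<=` S,
      forall phi psi, S phi -> S (Imp phi psi) -> S psi &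
      forall s phi, S phi -> S (fsubst s phi)].

Definition closed_DIS (S : set prob_formula) : Prop :=
  forall r phi psi, S (Iff phi psi) -> S (Iff (L r phi) (L r psi)).

Definition closed_ARCH (S : set prob_formula) : Prop :=
  forall (r : idx) gamma phi,
    (forall s : idx, sval s < sval r -> S (Imp gamma (L s phi))) ->
    S (Imp gamma (L r phi)).

(* In A3 and A4 the proviso r + t <= 1 is carried by [u : idx]. *)
Inductive axiom_plus : prob_formula -> Prop :=
| A1 phi : axiom_plus (L idx0 phi)
| A2 r : axiom_plus (L r Top)
| A3 (r t u : idx) phi psi : sval r + sval t = sval u ->
    axiom_plus (Imp (And (L r (And phi psi)) (L t (And phi (Neg psi))))
                    (L u phi))
| A4 (r s u : idx) phi psi : sval r + sval s = sval u ->
    axiom_plus (Imp (And (Neg (L r (And phi psi)))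
                         (Neg (L s (And phi (Neg psi)))))
                    (Neg (L u phi)))
| A5 (r s : idx) phi : 1 < sval r + sval s ->
    axiom_plus (Imp (L r phi) (Neg (L s (Neg phi)))).

Inductive axiom_H : prob_formula -> Prop :=
| axiom_H_plus phi : axiom_plus phi -> axiom_H phi
| Ax4p r phi : axiom_H (Imp (L r phi) (L idx1 (L r phi)))
| Ax5p r phi : axiom_H (Imp (Neg (L r phi)) (L idx1 (Neg (L r phi)))).

Definition Sigma_H : set prob_formula :=
  smallest (fun S => [/\ logic S, closed_DIS S & closed_ARCH S]) axiom_H.

Definition consistent_H (phi : prob_formula) : Prop := ~ Sigma_H (Imp phi Bot).

Definition Delta_gen (R : realType) {d} (Omega : measurableType d) :
    set (set (probability Omega R)) :=
  [set B | exists (E : set Omega) (r : idx), measurable E /\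
     B = [set mu : probability Omega R | ((ratr (sval r))%:E <= mu E)%E]].

(* Every [measurableType] is inhabited, so [ts_carrier] is nonempty. *)
Record type_space (R : realType) := TypeSpace {
  ts_disp : measure_display;
  ts_carrier : measurableType ts_disp;
  ts_type : ts_carrier -> probability ts_carrier R;
  ts_measurable : measurable_fun [set: ts_carrier]
    (ts_type : ts_carrier -> g_sigma_algebraType (Delta_gen R ts_carrier))
}.

Arguments ts_disp {R}.
Arguments ts_carrier {R}.
Arguments ts_type {R t}.

(* A [probability] is a function on all subsets, constrained only on the
   measurable ones, so equality of types is equality on measurable sets. *)
Definition same_type {R : realType} {X : type_space R} (w : ts_carrier X) :
    set (ts_carrier X) :=
  [set w' | forall E, measurable E -> ts_type w' E = ts_type w E].

Definition harsanyi {R : realType} (X : type_space R) : Prop :=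
  forall (w : ts_carrier X) (E : set (ts_carrier X)),
    measurable E -> same_type w `<=` E -> ts_type w E = 1%E.

Record prob_model (R : realType) := ProbModel {
  pm_space : type_space R;
  pm_val : AP -> set (ts_carrier pm_space);
  pm_val_measurable : forall p, measurable (pm_val p)
}.

Arguments pm_space {R}.
Arguments pm_val {R}.

Fixpoint sem {R : realType} (M : prob_model R) (phi : prob_formula) :
    set (ts_carrier (pm_space M)) :=
  match phi with
  | Atom p => pm_val M p
  | Neg phi1 => ~` sem M phi1
  | And phi1 phi2 => sem M phi1 `&` sem M phi2
  | L r phi1 => [set w | ((ratr (sval r))%:E <= ts_type w (sem M phi1))%E]
  end.

Definition harsanyi_valid (R : realType) (phi : prob_formula) : Prop :=
  forall M : prob_model R, harsanyi (pm_space M) -> forall w, sem M phi w.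

Definition harsanyi_satisfiable (R : realType) (phi : prob_formula) : Prop :=
  exists M : prob_model R, harsanyi (pm_space M) /\ exists w, sem M phi w.

(* Main.v *)
Require Import Defs.
From HB Require Import structures.
From mathcomp Require Import all_boot all_order all_algebra.
From mathcomp Require Import all_classical all_reals all_analysis.
From mathcomp Require Import lra.

Import Order.TTheory GRing.Theory Num.Theory.
Local Open Scope classical_set_scope.
Local Open Scope ring_scope.

(** Soundness is checked axiom by axiom; the two introspection axioms hold
    because the set of states satisfying [L r phi] is a union of classes of
    states of equal type, and a Harsanyi type gives its own class weight 1.

    Completeness rests on a finitely supported canonical model. A world is a
    Boolean valuation of letters and belief formulas satisfying every theorem,
    that is, a maximal consistent set, and the theorems are exactly what holds
    at all worlds ([Sigma_H_worlds], Lindenbaum's lemma). The degree of belief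
    of a world [a] in [phi] is the supremum of the [r] with [L r phi] true at
    [a]. Axioms A1 to A5 make it a finitely additive probability on formulas
    up to provable equivalence ([belief_split]), and introspection makes it
    0 or 1 on belief formulas ([belief_L]).

    Fix a formula [phi] true at some world, and let [Phi] be its finite list
    of subformulas. Two corrections turn degrees of belief into a model.

    A world may fail [L r psi] although its degree of belief in [psi] is [r].
    The rule ARCH removes this defect for finitely many formulas at once:
    every world agrees on the belief formulas of [Phi] with a world that is
    free of it ([archimedean_world_ex]).

    Degrees of belief need not extend to countably additive measures on the
    space of worlds. But [Phi] cuts this space into finitely many cells, and
    moving the weight of each cell to one chosen point in it keeps the weight
    of every member of [Phi] ([belief_cell_points]) and yields a finite
    combination of point masses.

    The type of a world is obtained this way from an Archimedean
    representative that is chosen as a function of its belief formulas in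
    [Phi] alone. The truth lemma follows by induction on subformulas. For the
    Harsanyi property, introspection makes every cell of positive weight share
    the belief formulas in [Phi] of the given world ([cell_introspection]);
    by the choice of representatives its points then have the same type. *)

(** * Boolean evaluation *)

Lemma beval_Imp a phi psi :
  beval a (Imp phi psi) = (beval a phi ==> beval a psi).
Proof. by rewrite /=; case: (beval a phi); case: (beval a psi). Qed.

Lemma beval_Iff a phi psi :
  beval a (Iff phi psi) = (beval a phi == beval a psi).
Proof. by rewrite /=; case: (beval a phi); case: (beval a psi). Qed.

Lemma beval_Top a : beval a Top.
Proof. by rewrite /= andbN. Qed.

(** * Soundness *)

Section Satisfaction.
Context {R : realType}.
Implicit Types M : prob_model R.

Lemma sem_measurable M phi : measurable (sem M phi).
Proof.
elim: phi => [p|phi mphi|phi mphi psi mpsi|r phi mphi] /=.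
- exact: pm_val_measurable.
- exact: measurableC.
- exact: measurableI.
- set B := [set mu : probability (ts_carrier (pm_space M)) R |
             ((ratr (sval r))%:E <= mu (sem M phi))%E].
  rewrite -[X in measurable X]setTI.
  apply: (ts_measurable R (pm_space M) measurableT B).
  by apply: sub_sigma_algebra; exists (sem M phi), r.
Qed.

Lemma sem_Imp M phi psi w :
  sem M (Imp phi psi) w <-> (sem M phi w -> sem M psi w).
Proof.
split=> /= [h hphi|h [hphi hpsi]]; last exact: hpsi (h hphi).
by apply: contrapT => hpsi; apply: h.
Qed.

Lemma sem_Iff M phi psi w :
  sem M (Iff phi psi) w <-> (sem M phi w <-> sem M psi w).
Proof.
split=> [[/sem_Imp ? /sem_Imp ?]|[? ?]]; first by split.
by split; apply/sem_Imp.
Qed.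

Lemma sem_Bot M w : ~ sem M Bot w.
Proof. by case. Qed.

Lemma sem_beval M w phi :
  beval (fun psi => `[< sem M psi w >]) phi = `[< sem M phi w >].
Proof.
elim: phi => [//|phi ih|phi ih psi ih'|//].
- by rewrite /= ih asbool_neg.
- by rewrite /= ih ih' asbool_and.
Qed.

(** Reading each letter [p] as the formula [s p] keeps the type space, hence
    the Harsanyi property; validity is therefore stable under substitution. *)
Definition subst_model M (s : AP -> prob_formula) : prob_model R :=
  ProbModel R (pm_space M) (fun p => sem M (s p))
    (fun p => sem_measurable M (s p)).

Lemma sem_fsubst M s phi : sem M (fsubst s phi) = sem (subst_model M s) phi.
Proof.
elim: phi => [//|phi h|phi h psi h'|r phi h] /=; first by rewrite h.
- by rewrite h h'.
- by rewrite h.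
Qed.

Lemma sem_split M w phi psi : (ts_type w (sem M phi) =
  ts_type w (sem M (And phi psi)) + ts_type w (sem M (And phi (Neg psi))))%E.
Proof.
rewrite -(measureU _ (sem_measurable _ _) (sem_measurable _ _)) /=.
  by rewrite -setIUr setUv setIT.
by rewrite setIACA setICr setI0.
Qed.

Lemma sem_Neg_compl M w phi : (1 =
  ts_type w (sem M phi) + ts_type w (sem M (Neg phi)))%E.
Proof.
rewrite -(measureU _ (sem_measurable _ _) (sem_measurable _ _)) /= ?setICr//.
by rewrite setUv probability_setT.
Qed.

Lemma axiom_plus_valid phi : axiom_plus phi -> harsanyi_valid R phi.
Proof.
case=> {phi} [phi|r|r t u phi psi rtu|r s u phi psi rsu|r s phi rs] M _ w.
- by rewrite /= rmorph0 measure_ge0.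
- have -> : sem M (L r Top) w = ((ratr (sval r))%:E <= ts_type w setT)%E.
    by congr (_ <= ts_type w _)%E; apply/seteqP; split=> // x _ [].
  rewrite probability_setT lee_fin -(rmorph1 (ratr : rat -> R)) ler_rat.
  by case/andP: (svalP r).
- apply/sem_Imp => -[] /= h1 h2; rewrite (sem_split _ _ phi psi) /= -rtu rmorphD.
  by rewrite EFinD; exact: leeD.
- apply/sem_Imp => -[] /= /negP + /negP; rewrite -!ltNge => h1 h2.
  apply/negP; rewrite -ltNge (sem_split _ _ phi psi) /= -rsu rmorphD.
  by rewrite EFinD; exact: lteD.
- apply/sem_Imp => /= h1; apply/negP; rewrite -ltNge.
  rewrite ltNge; apply/negP => h2.
  have := sem_Neg_compl M w phi; apply/eqP; rewrite lt_eqF//.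
  apply: lt_le_trans (leeD h1 h2).
  by rewrite -EFinD lte_fin -rmorphD -(rmorph1 (ratr : rat -> R)) ltr_rat.
Qed.

(** The states of type [T w] agree with [w] on belief formulas, because these
    only speak of the type; the Harsanyi property gives that event weight 1. *)
Lemma introspection_valid M w r phi : harsanyi (pm_space M) ->
  (sem M (L r phi) w -> sem M (L idx1 (L r phi)) w) /\
  (~ sem M (L r phi) w -> sem M (L idx1 (Neg (L r phi))) w).
Proof.
move=> hM; split=> h; rewrite /= rmorph1.
- rewrite (hM w [set w' | _])//.
    exact: (sem_measurable M (L r phi)).
  by move=> w' /(_ _ (sem_measurable M phi)) /= ->.
- rewrite (hM w (~` _))//.
    exact: (sem_measurable M (Neg (L r phi))).
  by move=> w' /(_ _ (sem_measurable M phi)) /= ->.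
Qed.

Lemma soundness phi : Sigma_H phi -> harsanyi_valid R phi.
Proof.
apply; split; last first.
  move=> {}phi [{}phi /axiom_plus_valid//|r {}phi|r {}phi] M hM w.
  - by apply/sem_Imp; apply: (introspection_valid M w r phi hM).1.
  - by apply/sem_Imp; apply: (introspection_valid M w r phi hM).2.
split; first split.
- move=> {}phi h M _ w.
  by have := h (fun psi => `[< sem M psi w >]); rewrite sem_beval => /asboolP.
- by move=> {}phi psi hphi himp M hM w; apply/sem_Imp: (hphi M hM w); apply: himp.
- by move=> s {}phi h M hM w; rewrite sem_fsubst; exact: h.
- move=> r {}phi psi h M hM w; apply/sem_Iff => /=.
  suff -> : sem M phi = sem M psi by [].
  by apply/seteqP; split=> x hx; have /sem_Iff[h1 h2] := h M hM x; auto.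
- move=> r gamma {}phi h M hM w; apply/sem_Imp => hg /=.
  rewrite leNgt; apply/negP => lt.
  have fin := fin_num_measure (ts_type w) (sem M phi) (sem_measurable M phi).
  move: lt; rewrite -(fineK fin) lte_fin => lt.
  have [q] := rat_in_itvoo lt.
  rewrite in_itv /= => /andP[lt1 lt2].
  have q0 : 0 <= q <= 1.
    apply/andP; split; first rewrite -(ler_rat R) rmorph0.
      apply: ltW; apply: le_lt_trans lt1.
      exact/fine_ge0/measure_ge0.
    rewrite ltr_rat in lt2.
    by apply: ltW; apply: lt_le_trans lt2 _; case/andP: (svalP r).
  have := h (exist _ q q0); rewrite /= -(ltr_rat R) => /(_ lt2 M hM w).
  move=> /sem_Imp /(_ hg) /=.
  by rewrite -(fineK fin) lee_fin leNgt lt1.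
Qed.

End Satisfaction.

(** * Worlds *)

Lemma Sigma_H_axiom phi : axiom_H phi -> Sigma_H phi.
Proof. exact: sub_gen_smallest. Qed.

Lemma Sigma_H_tautology phi : tautology phi -> Sigma_H phi.
Proof. by move=> h S [[[t _ _] _ _] _]; exact: t. Qed.

Lemma Sigma_H_mp phi psi : Sigma_H phi -> Sigma_H (Imp phi psi) -> Sigma_H psi.
Proof.
move=> h1 h2 S hS; have [[[_ mp _] _ _] _] := hS.
exact: mp (h1 S hS) (h2 S hS).
Qed.

Lemma Sigma_H_DIS : closed_DIS Sigma_H.
Proof.
move=> r phi psi h S hS; have [[_ DIS _] _] := hS.
exact: DIS (h S hS).
Qed.

Lemma Sigma_H_ARCH : closed_ARCH Sigma_H.
Proof.
move=> r gamma phi h S hS; have [[_ _ ARCH] _] := hS.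
by apply: ARCH => s /h; apply.
Qed.

Lemma Sigma_H_beval phi psi : Sigma_H phi ->
  (forall a, beval a phi -> beval a psi) -> Sigma_H psi.
Proof.
move=> hphi h; apply: Sigma_H_mp hphi _; apply: Sigma_H_tautology => a.
by rewrite beval_Imp; apply/implyP/h.
Qed.

(** A maximal consistent set, presented by a Boolean valuation of the
    propositional atoms (letters and belief formulas) whose true formulas are
    its members. *)
Definition world (a : prob_formula -> bool) : Prop :=
  forall theta, Sigma_H theta -> beval a theta.

(** Lindenbaum's lemma. The sets of valuations that contain, for some theorem
    [theta], all models of [theta] and [Neg phi] form a proper filter as soon
    as [phi] is not a theorem; an ultrafilter above it, read as the valuation
    making true what almost every valuation makes true, is a world
    refuting [phi]. *)
Lemma Sigma_H_worlds phi :
  Sigma_H phi <-> (forall a, world a -> beval a phi).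
Proof.
split=> [h a|h]; first exact.
apply: contrapT => nphi.
pose F : set_system (prob_formula -> bool) := [set A | exists2 theta,
  Sigma_H theta & [set a | beval a theta && ~~ beval a phi] `<=` A].
have FF : ProperFilter F.
  split; last split.
  - case=> theta htheta sub0; apply: nphi.
    apply: (Sigma_H_beval theta) htheta _ => a ha.
    by apply/negP => /negP na; apply: (sub0 a); rewrite /= ha.
  - by exists Top => //; apply: Sigma_H_tautology => a; exact: beval_Top.
  - move=> A B [theta ht hA] [eta he hB]; exists (And theta eta).
      apply: Sigma_H_mp he _; apply: (Sigma_H_beval theta) ht _ => a /= ->.
      by case: (beval a eta).
    by move=> a /= /andP[/andP[ta ea] na]; split;
      [apply: hA | apply: hB]; apply/andP.
  - by move=> A B sub [theta ht hA]; exists theta => //; exact: subset_trans sub.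
have [G [GU FG]] := ultraFilterLemma FF.
pose w chi := `[< G [set a | beval a chi] >].
have bevalw chi : beval w chi = w chi.
  elim: chi => [//|chi ih|chi ih eta ih'|//] /=.
  - rewrite ih -asbool_neg; apply/asboolP/asboolP => [nG|GN Gc].
      have [//|] := in_ultra_setVsetC [set a | beval a chi] GU.
      by apply: filterS => a /= /negP.
    have [a []] := filter_ex (filterI Gc GN).
    by rewrite /= => ->.
  - rewrite ih ih' -asbool_and; apply/asboolP/asboolP => [[Gc Ge]|Gce].
      by apply: filterS (filterI Gc Ge) => a /= [-> ->].
    by split; apply: filterS Gce => a /= /andP[].
have ww : world w.
  move=> theta ht; rewrite bevalw; apply/asboolP/FG.
  by exists theta => // a /andP[].
have := h w ww; rewrite bevalw => /asboolP Gphi.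
have GN : G [set a | ~~ beval a phi].
  apply: FG; exists Top; last by move=> a /andP[].
  by apply: Sigma_H_tautology => a; exact: beval_Top.
by have [a []] := filter_ex (filterI Gphi GN); rewrite /= => ->.
Qed.

Lemma world_Imp a phi psi : world a -> Sigma_H (Imp phi psi) ->
  beval a phi -> beval a psi.
Proof. by move=> wa /wa; rewrite beval_Imp => /implyP. Qed.

Lemma world_axiom a phi psi : world a -> axiom_H (Imp phi psi) ->
  beval a phi -> beval a psi.
Proof. by move=> wa /Sigma_H_axiom; exact: world_Imp. Qed.

Section WorldBelief.
Context (a : prob_formula -> bool) (wa : world a).

Lemma world_L_congr r phi psi :
  (forall b, world b -> beval b phi = beval b psi) -> a (L r phi) = a (L r psi).
Proof.
move=> h; have hS : Sigma_H (Iff phi psi).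
  by apply/Sigma_H_worlds => b wb; rewrite beval_Iff h.
have := wa _ (Sigma_H_DIS r _ _ hS).
by rewrite beval_Iff => /eqP.
Qed.

Lemma world_L0 phi : a (L idx0 phi).
Proof. by apply: (wa (L idx0 phi)); apply: Sigma_H_axiom; do 2!constructor. Qed.

Lemma world_L_top r phi : (forall b, world b -> beval b phi) -> a (L r phi).
Proof.
move=> h; rewrite (world_L_congr r phi Top).
  by apply: (wa (L r Top)); apply: Sigma_H_axiom; do 2!constructor.
by move=> b wb; rewrite h // beval_Top.
Qed.

Lemma world_A3 (r t u : idx) phi psi : sval r + sval t = sval u ->
  a (L r (And phi psi)) -> a (L t (And phi (Neg psi))) -> a (L u phi).
Proof.
move=> rtu h1 h2; apply: (world_axiom a
  (And (L r (And phi psi)) (L t (And phi (Neg psi)))) (L u phi) wa).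
  by constructor; exact: A3.
by rewrite /= h1.
Qed.

Lemma world_A4 (r s u : idx) phi psi : sval r + sval s = sval u ->
  a (L u phi) -> a (L r (And phi psi)) \/ a (L s (And phi (Neg psi))).
Proof.
move=> rsu h; apply/orP; apply: contraLR h; rewrite negb_or => h.
apply: (world_axiom a (And (Neg (L r (And phi psi)))
  (Neg (L s (And phi (Neg psi))))) (Neg (L u phi)) wa) h.
by constructor; exact: A4.
Qed.

Lemma world_A5 (r s : idx) phi : 1 < sval r + sval s ->
  a (L r phi) -> ~~ a (L s (Neg phi)).
Proof.
move=> rs; apply: (world_axiom a (L r phi) (Neg (L s (Neg phi))) wa).
by constructor; exact: A5.
Qed.

Lemma world_L_unsat (t : idx) phi : 0 < sval t ->
  (forall b, world b -> ~~ beval b phi) -> ~~ a (L t phi).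
Proof.
move=> t0 h; rewrite (world_L_congr t phi (Neg Top)); last first.
  by move=> b wb; rewrite (negbTE (h b wb)) /= andbN.
apply: (world_A5 idx1); first by rewrite ltrDl.
by apply: world_L_top => b _; exact: beval_Top.
Qed.

(** Splitting [psi] along itself, A4 turns weight [s + (r - s)] for [psi] into
    weight [s] for [psi] or positive weight for a contradiction. *)
Lemma world_L_le (r s : idx) psi : sval s <= sval r ->
  a (L r psi) -> a (L s psi).
Proof.
rewrite le_eqVlt => /predU1P[|lt h].
  by move=> e; rewrite (_ : s = r)//; exact: val_inj.
have h0 : 0 <= sval r - sval s <= 1.
  case: r s lt {h} => [r /= /andP[r0 r1]] [s /= /andP[s0 s1]] lt.
  by apply/andP; split; lra.
pose t : idx := exist _ (sval r - sval s) h0.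
have [||] := @world_A4 s t r psi psi _ h; first by rewrite /= addrC subrK.
  by rewrite (world_L_congr s _ psi)// => b _ /=; rewrite andbb.
have /negP : ~~ a (L t (And psi (Neg psi))).
  by apply: world_L_unsat => [|b _ /=]; rewrite ?subr_gt0 ?andbN.
by [].
Qed.

(** Split [psi] along [phi], spending A1 on the part outside [phi]. *)
Lemma world_L_mono r phi psi :
  (forall b, world b -> beval b phi -> beval b psi) ->
  a (L r phi) -> a (L r psi).
Proof.
move=> h hphi; apply: (world_A3 r idx0 r psi phi); rewrite ?addr0//.
  rewrite (world_L_congr r _ phi)// => b wb /=.
  by case: (boolP (beval b phi)) => [/(h b wb) ->|]; rewrite ?andbT ?andbF.
exact: world_L0.
Qed.

End WorldBelief.

(** * The degree of belief of a world *)

Section Belief.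
Context {R : realType}.
Implicit Types (a : prob_formula -> bool) (phi psi : prob_formula).

Definition belief a phi : R :=
  sup [set x | exists2 r : idx, a (L r phi) & x = ratr (sval r)].

Context {a : prob_formula -> bool} (wa : world a).

Let ratr01 (r : idx) : 0 <= (ratr (sval r) : R) <= 1.
Proof.
rewrite -(rmorph0 (ratr : rat -> R)) -(rmorph1 (ratr : rat -> R)) !ler_rat.
exact: svalP r.
Qed.

Let has_sup_belief phi :
  has_sup [set x : R | exists2 r : idx, a (L r phi) & x = ratr (sval r)].
Proof.
split; first by exists (ratr 0), idx0 => //; exact: world_L0.
by exists 1 => _ [r _ ->]; case/andP: (ratr01 r).
Qed.

Lemma belief_ge r phi : a (L r phi) -> ratr (sval r) <= belief a phi.
Proof. by move=> h; apply: sup_upper_bound => //=; exists r. Qed.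

Lemma belief_approx phi e : 0 < e ->
  exists2 r : idx, a (L r phi) & belief a phi - e < ratr (sval r).
Proof.
move=> e0; have [_ [r ? ->] ?] := sup_adherent e0 (has_sup_belief phi).
by exists r.
Qed.

Lemma belief_gt (r : idx) phi : ratr (sval r) < belief a phi -> a (L r phi).
Proof.
move=> lt; have [|s hs] := belief_approx phi (belief a phi - ratr (sval r)).
  by rewrite subr_gt0.
rewrite opprB addrC subrK ltr_rat => rs.
by apply: world_L_le hs => //; exact: ltW.
Qed.

Lemma belief_ge0 phi : 0 <= belief a phi.
Proof.
by rewrite -(rmorph0 (ratr : rat -> R)); apply: belief_ge idx0 _ _; exact: world_L0.
Qed.

Lemma belief_le1 phi : belief a phi <= 1.
Proof.
apply: ge_sup; first by case: (has_sup_belief phi).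
by move=> _ [r _ ->]; case/andP: (ratr01 r).
Qed.

Lemma belief_congr phi psi :
  (forall b, world b -> beval b phi = beval b psi) -> belief a phi = belief a psi.
Proof.
move=> h; rewrite /belief; congr sup; apply/seteqP.
split=> x [r + ->] => hr; exists r => //; move: hr;
  by rewrite (world_L_congr _ wa r _ _ h).
Qed.

Lemma belief_L1 phi : a (L idx1 phi) -> belief a phi = 1.
Proof.
move=> h; apply/eqP; rewrite eq_le belief_le1 -[X in X <= _](rmorph1 (ratr : rat -> R)).
exact: belief_ge idx1 _ h.
Qed.

(** Axiom A3 gives superadditivity (A5 keeping the sum of the two weights
    at most 1, where A3 applies), and A4 gives subadditivity. *)
Lemma belief_split phi psi :
  belief a phi = belief a (And phi psi) + belief a (And phi (Neg psi)).
Proof.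
set f := belief a phi; set g := belief a _; set h := belief a _.
apply/eqP; rewrite eq_le; apply/andP; split; rewrite leNgt; apply/negP => lt.
- (* Rationals just above the two parts still sum below the whole; neither
     part has that weight, so by A4 neither does the whole. *)
  have [q1] : exists q, ratr q \in `]g, (g + (f - (g + h)) / 2)[.
    by apply: rat_in_itvoo; lra.
  rewrite in_itv /= => /andP[gq qg].
  have [q2] : exists q, ratr q \in `]h, (h + (f - (g + h)) / 2)[.
    by apply: rat_in_itvoo; lra.
  rewrite in_itv /= => /andP[hq qh].
  have := belief_le1 phi; rewrite -/f => f1.
  have := belief_ge0 (And phi psi); rewrite -/g => g0.
  have := belief_ge0 (And phi (Neg psi)); rewrite -/h => h0.
  have ratr_idx q : 0 <= (ratr q : R) -> (ratr q : R) <= 1 -> 0 <= q <= 1.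
    by move=> q0 q1'; rewrite -!(ler_rat R) rmorph0 rmorph1 q0.
  have i1 : 0 <= q1 <= 1 by apply: ratr_idx; lra.
  have i2 : 0 <= q2 <= 1 by apply: ratr_idx; lra.
  have i12 : 0 <= q1 + q2 <= 1 by apply: ratr_idx; rewrite rmorphD /=; lra.
  have hL : a (L (exist _ (q1 + q2) i12) phi).
    by apply: belief_gt; rewrite rmorphD /= -/f; lra.
  have [//||] := @world_A4 _ wa (exist _ q1 i1) (exist _ q2 i2) _ _ psi _ hL.
    by move=> /belief_ge /=; rewrite -/g; lra.
  by move=> /belief_ge /=; rewrite -/h; lra.
- have e0 : 0 < (g + h - f) / 2 by lra.
  have [r hr rg] := belief_approx (And phi psi) _ e0.
  have [s hs sh] := belief_approx (And phi (Neg psi)) _ e0.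
  rewrite -/g -/h in rg sh.
  have [le1|gt1] := leP (sval r + sval s) 1.
    have i : 0 <= sval r + sval s <= 1.
      by rewrite le1 addr_ge0//; [case/andP: (svalP r)|case/andP: (svalP s)].
    have /belief_ge : a (L (exist _ (sval r + sval s) i) phi).
      exact: world_A3 hs.
    by rewrite rmorphD /= -/f; lra.
  have /negP := world_A5 _ wa _ _ _ gt1 hr; apply.
  by apply: world_L_mono hs => // b _ /= /andP[-> ->].
Qed.

Lemma belief_unsat phi :
  (forall b, world b -> ~~ beval b phi) -> belief a phi = 0.
Proof.
move=> h; have := belief_split phi phi.
rewrite (belief_congr (And phi phi) phi); last by move=> b _ /=; rewrite andbb.
rewrite (belief_congr (And phi (Neg phi)) phi); first by lra.
by move=> b wb /=; rewrite (negbTE (h b wb)).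
Qed.

Lemma belief_mono phi psi :
  (forall b, world b -> beval b phi -> beval b psi) ->
  belief a phi <= belief a psi.
Proof.
move=> h; rewrite (belief_split psi phi).
rewrite (belief_congr (And psi phi) phi) ?lerDl ?belief_ge0// => b wb /=.
by case: (boolP (beval b phi)) => [/(h b wb) ->|]; rewrite ?andbT ?andbF.
Qed.

Lemma belief_valid phi : (forall b, world b -> beval b phi) -> belief a phi = 1.
Proof. by move=> h; apply: belief_L1; exact: world_L_top. Qed.

Lemma belief_Neg phi : belief a (Neg phi) = 1 - belief a phi.
Proof.
have := belief_split Top phi.
rewrite (belief_valid Top) => [|b _]; last exact: beval_Top.
rewrite (belief_congr (And Top phi) phi) => [|b _ /=]; last by rewrite andbN.
rewrite (belief_congr (And Top (Neg phi)) (Neg phi)) => [|b _ /=].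
  by lra.
by rewrite andbN.
Qed.

(** The introspection axioms give certainty of [L r phi] in one case and of
    its negation in the other. *)
Lemma belief_L r phi : belief a (L r phi) = (a (L r phi))%:R.
Proof.
have [h|h] := boolP (a (L r phi)).
  apply: belief_L1; apply: (world_axiom a (L r phi) (L idx1 (L r phi)) wa) h.
  exact: Ax4p.
have : belief a (Neg (L r phi)) = 1.
  apply: belief_L1; apply: (world_axiom a (Neg (L r phi)) (L idx1 (Neg (L r phi))) wa) h.
  exact: Ax5p.
by rewrite belief_Neg /= mulr0n; lra.
Qed.

End Belief.

(** * Archimedean worlds *)

HB.instance Definition _ := gen_eqMixin prob_formula.

Definition is_belief (phi : prob_formula) : bool :=
  if phi is L _ _ then true else false.

Definition beliefs (Phi : seq prob_formula) := [seq chi <- Phi | is_belief chi].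

Lemma mem_beliefs Phi r psi : (L r psi \in beliefs Phi) = (L r psi \in Phi).
Proof. by rewrite mem_filter. Qed.

Definition agree (l : seq prob_formula) (a b : prob_formula -> bool) : Prop :=
  {in l, forall chi, beval a chi = beval b chi}.

Definition diagram (a : prob_formula -> bool) (l : seq prob_formula) :=
  foldr (fun chi => And (if beval a chi then chi else Neg chi)) Top l.

Lemma beval_diagram a l b : reflect (agree l b a) (beval b (diagram a l)).
Proof.
elim: l => [|chi l ih].
  by rewrite beval_Top; constructor.
rewrite [diagram _ _]/=; set lit := if _ then _ else _.
have -> : beval b (And lit (diagram a l)) = beval b lit && beval b (diagram a l).
  by [].
have -> : beval b lit = (beval b chi == beval a chi).
  by rewrite /lit; case: (beval a chi) => /=; case: (beval b chi).
apply: (iffP andP) => [[/eqP h /ih hl] xi|h].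
  rewrite inE => /predU1P[->|/hl].
    exact: h.
  by [].
split; first by apply/eqP; apply: h; exact: mem_head.
by apply/ih => xi xil; apply: h; rewrite inE xil orbT.
Qed.

(** A world may make [L s psi] true for all [s < r] but [L r psi] false, so
    that its degree of belief in [psi] is [r] although it denies [L r psi]. On
    the worlds that avoid this for the formulas [L r psi] of [Phi], degrees of
    belief determine the truth of these formulas. *)
Definition archimedean_on (Phi : seq prob_formula) (a : prob_formula -> bool) :=
  forall r psi, L r psi \in Phi -> ~~ a (L r psi) ->
  exists2 s : idx, sval s < sval r & ~~ a (L s psi).

Lemma archimedean_belief {R : realType} Phi a r psi : world a ->
  archimedean_on Phi a -> L r psi \in Phi ->
  a (L r psi) = (ratr (sval r) <= belief a psi :> R).
Proof.
move=> wa arch Phir; apply/idP/idP => [|h]; first exact: belief_ge.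
apply/negPn/negP => /(arch _ _ Phir)[s sr /negP]; apply.
by apply: (belief_gt (R := R)) => //; apply: lt_le_trans h; rewrite ltr_rat.
Qed.

(** The contrapositive of the rule ARCH, read on worlds. *)
Lemma ARCH_world gamma (r : idx) psi :
  (exists a, [/\ world a, beval a gamma & ~~ a (L r psi)]) ->
  exists2 s : idx, sval s < sval r &
    exists a, [/\ world a, beval a gamma & ~~ a (L s psi)].
Proof.
case=> a [wa ga /negP nLr]; apply: contrapT => h; apply: nLr.
apply: (world_Imp a gamma (L r psi) wa) ga.
apply: Sigma_H_ARCH => s sr; apply/Sigma_H_worlds => b wb.
rewrite beval_Imp; apply/implyP => gb; apply/negPn/negP => nLs.
by apply: h; exists s => //; exists b.
Qed.

(** Each formula [Neg (L s psi)] obtained for one member [L r psi] of [l] is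
    added to [gamma] before the next member is treated, so that a single world
    serves for all of them. *)
Lemma ARCH_world_seq (l : seq prob_formula) gamma :
  (exists2 a, world a & beval a gamma) ->
  (forall b, world b -> beval b gamma ->
    forall r psi, L r psi \in l -> ~~ b (L r psi)) ->
  exists a, [/\ world a, beval a gamma & forall r psi, L r psi \in l ->
    exists2 s : idx, sval s < sval r & ~~ a (L s psi)].
Proof.
elim: l gamma => [|chi l ih] gamma [a wa ga] h; first by exists a.
have hl b : world b -> beval b gamma ->
    forall r psi, L r psi \in l -> ~~ b (L r psi).
  by move=> wb gb r psi rl; apply: h; rewrite // inE rl orbT.
have [|nL] := boolP (is_belief chi); last first.
  have [b [wb gb hb]] := ih gamma (ex_intro2 _ _ a wa ga) hl.
  exists b; split=> // r psi; rewrite inE => /predU1P[e|]; last exact: hb.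
  by rewrite -e in nL.
case: chi h => // r psi h _.
have [|s sr [b [wb gb Lb]]] := ARCH_world gamma r psi.
  by exists a; split=> //; apply: h (mem_head _ _).
have [||c [wc /andP[gc Lc] hc]] := ih (And gamma (Neg (L s psi))).
- by exists b => //=; rewrite gb.
- by move=> d wd /andP[gd _]; exact: hl.
exists c; split=> // r' psi'; rewrite inE => /predU1P[[-> ->]|]; last exact: hc.
by exists s.
Qed.

Lemma archimedean_world_ex Phi a : world a ->
  exists b, [/\ world b, agree (beliefs Phi) b a & archimedean_on Phi b].
Proof.
move=> wa.
have [||b [wb /beval_diagram gb hb]] :=
    ARCH_world_seq [seq chi <- Phi | is_belief chi && ~~ beval a chi]
      (diagram a (beliefs Phi)).
- by exists a => //; apply/beval_diagram.
- move=> b wb /beval_diagram ab r psi; rewrite mem_filter => /andP[/= nL rP].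
  by have /= -> := ab (L r psi) _; rewrite ?mem_beliefs.
exists b; split=> // r psi rP nL; apply: hb; rewrite mem_filter rP andbT /=.
by have /= <- := gb (L r psi) _; rewrite ?mem_beliefs.
Qed.

(** The choice depends on [a] only through its belief formulas in [Phi]:
    states with the same beliefs are to have the same type. *)
Definition archimedean_rep (Phi : seq prob_formula) a : prob_formula -> bool :=
  xget (fun=> false) [set b |
    [/\ world b, agree (beliefs Phi) b a & archimedean_on Phi b]].

Lemma archimedean_repP Phi a : world a -> let b := archimedean_rep Phi a in
  [/\ world b, agree (beliefs Phi) b a & archimedean_on Phi b].
Proof. by move=> wa; exact: (xgetPex _ (archimedean_world_ex Phi a wa)). Qed.

Lemma archimedean_rep_agree Phi a b : agree (beliefs Phi) a b ->
  archimedean_rep Phi a = archimedean_rep Phi b.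
Proof.
move=> ab; rewrite /archimedean_rep; congr xget; apply/seteqP.
by split=> c /= [wc h arch]; split=> // chi hchi; rewrite h ?ab.
Qed.

(** * Cells: the finite partition generated by a list of formulas *)

Fixpoint cells (l : seq prob_formula) (theta : prob_formula) :=
  if l is chi :: l' then
    cells l' (And theta chi) ++ cells l' (And theta (Neg chi))
  else [:: theta].

Lemma cells_sub l theta c a : c \in cells l theta -> beval a c -> beval a theta.
Proof.
elim: l theta => [|chi l ih] theta /=; first by rewrite inE => /eqP ->.
by rewrite mem_cat => /orP[] /ih h /h /= /andP[].
Qed.

Lemma cells_agree l theta c a b : c \in cells l theta ->
  beval a c -> beval b c -> agree l a b.
Proof.
elim: l theta => [//|chi l ih] theta /=; rewrite mem_cat => /orP[] hc ha hb xi;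
  rewrite inE => /predU1P[->|]; do ?exact: ih hc ha hb xi.
  have /andP[_ ea] := cells_sub _ _ _ _ hc ha.
  have /andP[_ eb] := cells_sub _ _ _ _ hc hb.
  exact: etrans ea (esym eb).
have /andP[_ /negbTE ea] := cells_sub _ _ _ _ hc ha.
have /andP[_ /negbTE eb] := cells_sub _ _ _ _ hc hb.
exact: etrans ea (esym eb).
Qed.

Definition cell_point (c : prob_formula) : prob_formula -> bool :=
  xget (fun=> false) [set b | world b /\ beval b c].

Lemma cell_pointP c b : world b -> beval b c ->
  world (cell_point c) /\ beval (cell_point c) c.
Proof.
by move=> wb bc; apply: (@xgetPex _ _ [set b | world b /\ beval b c]); exists b.
Qed.

Section CellBelief.
Context {R : realType} {a : prob_formula -> bool} (wa : world a).

Lemma belief_cells l theta psi : belief a (And psi theta) =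
  \sum_(c <- cells l theta) belief a (And psi c) :> R.
Proof.
elim: l theta => [|chi l ih] theta; first by rewrite big_seq1.
rewrite big_cat -!ih /= (belief_split wa _ chi); congr (_ + _);
  by apply: belief_congr => // b _ /=; rewrite andbA.
Qed.

Lemma sum_belief_cells l : \sum_(c <- cells l Top) belief a c = 1 :> R.
Proof.
rewrite -(belief_valid wa (And Top Top)) => [|b _ /=]; last by rewrite andbN.
rewrite (belief_cells l); apply: eq_bigr => c _.
by apply: belief_congr => // b _ /=; rewrite andbN.
Qed.

(** An event that coincides on worlds with a formula of the list is, up to
    inconsistent cells, the union of the cells on which that formula holds. *)
Lemma belief_cell_points l psi (E : set (prob_formula -> bool)) : psi \in l ->
  (forall b, world b -> (b \in E) = beval b psi) ->
  \sum_(c <- cells l Top) belief a c * (cell_point c \in E)%:R =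
  belief a psi :> R.
Proof.
move=> psil hE; rewrite (belief_congr wa psi (And psi Top)); last first.
  by move=> b _ /=; rewrite !andbN andbT.
rewrite (belief_cells l) big_seq [RHS]big_seq; apply: eq_bigr => c hc.
have [[b wb bc]|unsat] := pselect (exists2 b, world b & beval b c); last first.
  by rewrite !belief_unsat ?mul0r// => b wb; apply/negP;
    [move=> /andP[_ bc]|move=> bc]; apply: unsat; exists b.
have [wp pc] := cell_pointP c b wb bc.
have cpsi d : beval d c -> beval d psi = beval (cell_point c) psi.
  by move=> dc; exact: (cells_agree _ _ _ _ _ hc dc pc).
rewrite hE//; have [h|h] := boolP (beval (cell_point c) psi).
  rewrite mulr1; apply: belief_congr => // d _ /=.
  have [dc|] := boolP (beval d c); last by rewrite andbF.
  by rewrite andbT; exact: esym (etrans (cpsi d dc) h).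
rewrite mulr0 belief_unsat// => d _; apply/negP => /andP[hd dc].
by move/negP: h; apply; exact: etrans (esym (cpsi d dc)) hd.
Qed.

(** By [belief_L], [a] gives weight 0 to any formula that entails a belief
    different from its own. *)
Lemma cell_introspection l r psi c d : L r psi \in l -> c \in cells l Top ->
  belief a c != 0 :> R -> world d -> beval d c -> d (L r psi) = a (L r psi).
Proof.
move=> hl hc c0 wd dc; apply/eqP; apply: contraNT c0 => da.
rewrite eq_le (belief_ge0 wa) andbT.
have agr b : beval b c -> b (L r psi) = d (L r psi).
  by move=> bc; exact: (cells_agree _ _ _ _ _ hc bc dc (L r psi) hl).
have [h|h] := boolP (a (L r psi)).
  have <- : belief a (Neg (L r psi)) = 0 :> R.
    by rewrite belief_Neg// belief_L// h subrr.
  apply: belief_mono => // b _ /agr /= ->.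
  by move: da; rewrite h; case: (d _).
have <- : belief a (L r psi) = 0 :> R by rewrite belief_L// (negbTE h).
apply: belief_mono => // b _ /agr /= ->.
by move: da; rewrite (negbTE h); case: (d _).
Qed.

End CellBelief.

(** * The finitely supported canonical model *)

Lemma finite_support_probability {d} {T : measurableType d} {R : realType}
    {I : Type} (s : seq I) (p : I -> R) (x : I -> T) :
  (forall i, 0 <= p i) -> \sum_(i <- s) p i = 1 ->
  exists P : probability T R, forall A,
    P A = (\sum_(i <- s) p i * (x i \in A)%:R)%:E.
Proof.
case: s => [|i0 s] p0; first by rewrite big_nil => /eqP; rewrite eq_sym oner_eq0.
move: {s}(i0 :: s) => s p1.
pose m := msum (fun k => mscale (NngNum (p0 (nth i0 s k))) (dirac (x (nth i0 s k))))
  (size s).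
have mE A : m A = (\sum_(i <- s) p i * (x i \in A)%:R)%:E.
  rewrite (big_nth i0) big_mkord -sumEFin; apply: eq_bigr => k _ /=.
  by rewrite /mscale /= diracE.
have m1 : m setT = 1%E.
  rewrite mE; congr EFin; rewrite -[RHS]p1; apply: eq_bigr => i _.
  by rewrite in_setT /= mulr1.
pose P : probability T R := HB.pack m (Measure_isProbability.Build _ _ _ m m1).
by exists P.
Qed.

Fixpoint subformulas (phi : prob_formula) : seq prob_formula :=
  phi :: match phi with
         | Atom _ => [::]
         | Neg phi1 => subformulas phi1
         | And phi1 phi2 => subformulas phi1 ++ subformulas phi2
         | L _ phi1 => subformulas phi1
         end.

(** Valuations that are not worlds are kept so that the type is inhabited. The
    discrete sigma-algebra makes every question of measurability trivial. *)
Definition valuation_space :=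
  g_sigma_algebraType [set: set (prob_formula -> bool)].

Lemma valuation_measurable (A : set valuation_space) : measurable A.
Proof. exact: sub_sigma_algebra. Qed.

(** Valuations that are not worlds get a point mass at themselves, which has
    the Harsanyi property and leaves the types of the worlds untouched. *)
Lemma world_satisfiable (R : realType) a phi : world a -> beval a phi ->
  harsanyi_satisfiable R phi.
Proof.
move=> wa aphi; set Phi := subformulas phi.
have /choice[T HT] : forall b : valuation_space,
    exists P : probability valuation_space R,
      (world b -> forall A : set valuation_space, P A =
        (\sum_(c <- cells Phi Top)
           belief (archimedean_rep Phi b) c * (cell_point c \in A)%:R)%:E) /\
      (~ world b -> forall A : set valuation_space, A b -> P A = 1%E).
  move=> b.
  have [wb|nwb] := pselect (world b).
    have [wr _ _] := archimedean_repP Phi b wb.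
    have [P HP] := finite_support_probability (T := valuation_space)
      (cells Phi Top) (belief (R := R) (archimedean_rep Phi b)) cell_point
      (belief_ge0 wr) (sum_belief_cells wr Phi).
    by exists P.
  exists (dirac b); split=> // _ A Ab.
  by rewrite /= diracE mem_set.
have mT : measurable_fun [set: valuation_space]
    (T : valuation_space -> g_sigma_algebraType (Delta_gen R valuation_space)).
  by move=> _ B _; exact: valuation_measurable.
pose X := TypeSpace R _ valuation_space T mT.
pose M := ProbModel R X (fun p => [set b | b (Atom p)])
  (fun p => valuation_measurable _).
have truth psi : {subset subformulas psi <= Phi} ->
    forall b, world b -> sem M psi b <-> beval b psi.
  elim: psi => [p|psi ih|psi ih psi' ih'|r psi ih] sub b wb /=.
  - by [].
  - have {}ih := ih (fun x hx => sub x (mem_behead (s := _ :: _) hx)) b wb.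
    by split=> [h|/negP h]; [apply/negP|]; move=> /ih.
  - have {}ih := ih _ b wb; have {}ih' := ih' _ b wb.
    rewrite ih ?ih'; first exact: (rwP andP).
    + by move=> x hx; apply: sub; rewrite /= inE mem_cat hx !orbT.
    + by move=> x hx; apply: sub; rewrite /= inE mem_cat hx !orbT.
  - have subpsi : {subset subformulas psi <= Phi}.
      by move=> x hx; apply: sub; rewrite /= inE hx orbT.
    have psiP : psi \in Phi by apply: subpsi; case: (psi) => *; exact: mem_head.
    have LP : L r psi \in Phi by apply: sub; exact: mem_head.
    have [wr agr arch] := archimedean_repP Phi b wb.
    rewrite (HT b).1// lee_fin (belief_cell_points wr Phi psi)//; last first.
      by move=> c wc; apply/idP/idP => [/set_mem /(ih subpsi c wc)//|h];
        apply/mem_set/(ih subpsi c wc).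
    rewrite -(archimedean_belief Phi)//.
    by have /= -> := agr (L r psi) _; rewrite ?mem_beliefs.
exists M; split; last by exists a; apply/truth.
(* Harsanyi property: every point of positive weight has the type of [b]. *)
move=> b E _ subE.
have [wb|nwb] := pselect (world b); last first.
  by rewrite (HT b).2//; exact: subE.
have [wr agr arch] := archimedean_repP Phi b wb.
rewrite (HT b).1//; congr EFin.
rewrite -[RHS](sum_belief_cells wr Phi) big_seq [RHS]big_seq.
apply: eq_bigr => c hc.
(* An inconsistent cell contains no world, and its point is arbitrary. *)
have [[d wd dc]|unsat] := pselect (exists2 d, world d & beval d c); last first.
  rewrite belief_unsat ?mul0r// => d wd; apply/negP => dc.
  by apply: unsat; exists d.
have [wp pc] := cell_pointP c d wd dc.
have [->|c0] := eqVneq (belief (archimedean_rep Phi b) c) (0 : R).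
  by rewrite mul0r.
rewrite mem_set ?mulr1//; apply: subE => A _.
rewrite !(HT _).1//; congr (_%:E); apply: eq_bigr => e _.
congr (belief _ _ * _); apply: archimedean_rep_agree => chi hchi.
rewrite -agr//; move: hchi; rewrite mem_filter => /andP[].
case: chi => // r psi _ hP /=.
have := cell_introspection wr Phi r psi c (cell_point c) hP hc c0 wp pc.
by move=> ->; have /= -> := agr (L r psi) _; rewrite ?mem_beliefs.
Qed.

(** * Soundness and completeness combined *)

Theorem theorem3p5 (R : realType) :
  (forall phi : prob_formula, Sigma_H phi <-> harsanyi_valid R phi) /\
  (forall phi : prob_formula, consistent_H phi <-> harsanyi_satisfiable R phi).
Proof.
have completeness phi : Sigma_H phi <-> harsanyi_valid R phi.
  split; first exact: soundness.
  move=> valid; apply/Sigma_H_worlds => a wa; apply/negPn/negP => nphi.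
  have [M [hM [w nw]]] := world_satisfiable R a (Neg phi) wa nphi.
  exact: nw (valid M hM w).
split=> // phi; rewrite /consistent_H completeness; split=> [h|[M [hM [w hw]]] h].
  apply: contrapT => nsat; apply: h => M hM w; apply/sem_Imp => hw.
  by case: nsat; exists M; split=> //; exists w.
by have /sem_Imp/(_ hw)/sem_Bot := h M hM w.
Qed.
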